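(* Let $p$ be an odd prime, let $k\ge 1$, and let $A_k$ be the core of the group $G_k$ of units modulo $p^k$. For every subgroup $S$ of $A_k$ that properly contains the trivial subgroup $\{1\}$, $$\sum_{s\in S} s\equiv 0 \pmod{p^k}.$$
   Context: $p$ is an odd prime and $Z_k$ is the ring of integers modulo $p^k$. $G_k$ is the group of units of $Z_k$ under multiplication; it is cyclic of order $(p-1)p^{k-1}$. The core $A_k$ is the unique subgroup of $G_k$ of order $p-1$; its elements are the $n\in G_k$ with $n^p\equiv n \pmod{p^k}$. *)

(* Defs.v *)
From mathcomp Require Import all_boot all_order all_algebra all_fingroup all_solvable.

Set Implicit Arguments.
Unset Strict Implicit.
Unset Printing Implicit Defensive.

Import GRing.Theory.

(* The definite description "the subgroup of order p - 1" of the unit group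
   modulo p ^ k.  The lemmas card_core and core_unique show that, for p prime
   and k >= 1, such a subgroup exists and is unique, so that the default value
   1 is never used; mem_core identifies its elements as the u with u ^+ p = u. *)
Definition core (p k : nat) : {group {unit 'Z_(p ^ k)}} :=
  odflt 1%G [pick A : {group {unit 'Z_(p ^ k)}} | #|A| == p.-1].

Section CoreFacts.

Variables (p k : nat).
Hypotheses (p_pr : prime p) (k_gt0 : 0 < k).
Local Notation gT := {unit 'Z_(p ^ k)}.

Lemma card_units_pk : #|[set: gT]| = p.-1 * p ^ k.-1.
Proof. by rewrite card_units_Zp ?expn_gt0 ?prime_gt0 // totient_pfactor. Qed.

Lemma units_pk_abelian : abelian [set: gT].
Proof. exact: units_Zp_abelian. Qed.

Lemma p'pred : (p^').-nat p.-1.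
Proof.
have p_gt1 := prime_gt1 p_pr.
rewrite p'natE // gtnNdvd //; by case: p p_gt1 => [|[]].
Qed.

Lemma p'part_card : (p.-1 * p ^ k.-1)`_(p^') = p.-1.
Proof.
have p1_gt0 : 0 < p.-1 by rewrite -ltnS prednK ?prime_gt0 ?prime_gt1.
have pk_gt0 : 0 < p ^ k.-1 by rewrite expn_gt0 prime_gt0.
rewrite (partnM _ p1_gt0 pk_gt0) (part_pnat_id p'pred).
by rewrite part_p'nat ?muln1 // pnatNK pnatX pnat_id.
Qed.

Lemma Hall_card_pred (A : {group gT}) : #|A| = p.-1 -> (p^').-Hall([set: gT])%g A.
Proof.
by move=> cardA; rewrite pHallE subsetT cardA card_units_pk p'part_card eqxx.
Qed.

Lemma core_uniq_aux (A : {group gT}) : #|A| = p.-1 -> A = 'O_(p^')([set: gT])%G.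
Proof.
move=> /Hall_card_pred hallA; apply/val_inj/esym/normal_Hall_pcore => //=.
by rewrite -sub_abelian_normal ?subsetT ?units_pk_abelian.
Qed.

Lemma card_core : #|core p k| = p.-1.
Proof.
rewrite /core; case: pickP => [A /eqP // | noA].
have [A hallA] := Hall_exists (p^') (abelian_sol units_pk_abelian).
by have := noA A; rewrite (card_Hall hallA) card_units_pk p'part_card eqxx.
Qed.

Lemma core_unique (A : {group gT}) : #|A| = p.-1 -> A = core p k.
Proof. by move=> cA; rewrite (core_uniq_aux cA) -(core_uniq_aux card_core). Qed.

Lemma mem_core (u : gT) : (u \in core p k) = (u ^+ p == u)%g.
Proof.
have p_gt0 := prime_gt0 p_pr.
have -> : (u ^+ p = u * u ^+ p.-1)%g by rewrite -expgS prednK.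
rewrite -(inj_eq (mulgI u^-1%g)) mulKg mulVg.
rewrite -order_dvdn; apply/idP/idP => [uA | u_p].
  by rewrite -card_core order_dvdG.
rewrite (core_uniq_aux card_core) /=.
have hallO := Hall_card_pred card_core.
rewrite (core_uniq_aux card_core) in hallO.
rewrite (mem_normal_Hall hallO) ?pcore_normal ?inE //.
exact: pnat_dvd u_p p'pred.
Qed.

End CoreFacts.

(* Main.v *)
(** If some [g] in [S] has [g - 1] invertible, then multiplication by [g] permutes
    [S], so [(g - 1) * \sum_(s in S) s = 0] and the sum vanishes. Every [g != 1] of
    the core has this property: otherwise [g = 1 %[mod p]], hence
    [1 + g + ... + g ^+ (p - 2) = p - 1 %[mod p]] is invertible, and
    [g ^+ (p - 1) - 1 = (g - 1) * (1 + g + ... + g ^+ (p - 2)) = 0] forces [g = 1]. *)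
Require Import Defs.
From mathcomp Require Import all_boot all_order all_algebra all_fingroup all_solvable.

Import GRing.Theory.

Lemma natr_unit_pk (p k n : nat) : prime p -> (0 < k)%N ->
  ((n%:R : 'Z_(p ^ k)) \is a GRing.unit)%R = ~~ (p %| n).
Proof.
move=> p_pr k_gt0.
(* The side condition [1 < p ^ k] is obtained as [1 ^ k < p ^ k]. *)
by rewrite unitZpE ?coprime_pexpl ?prime_coprime // -(exp1n k) ltn_exp2r ?prime_gt1.
Qed.

Lemma sub1_unit_pk (p k : nat) (u : 'Z_(p ^ k)) : prime p -> (0 < k)%N ->
  (u ^+ p.-1 = 1 -> u != 1 -> u - 1 \is a GRing.unit)%R.
Proof.
move=> p_pr k_gt0 u_p1; apply: contraR => nUu1.
(* Lifting [u] to the natural number [d.+1] makes reduction mod [p] available. *)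
pose d : nat := (u - 1)%R.
have p_d : p %| d by rewrite -[p %| d]negbK -(@natr_unit_pk p k) // natr_Zp.
have def_u : (u = d.+1%:R)%R by rewrite -natr1 natr_Zp subrK.
have sum_mod : \sum_(i < p.-1) d.+1 ^ i = p.-1 %[mod p].
  have d1_mod i : d.+1 ^ i = 1 %[mod p].
    by rewrite -modnXm -addn1 -modnDml (eqP p_d) modnXm exp1n.
  rewrite -modn_summ (eq_bigr (fun=> 1 %% p)) => [|i _]; last exact: d1_mod.
  by rewrite modn_summ sum1_card card_ord.
have sum_unit : (\sum_(i < p.-1) u ^+ i \is a GRing.unit)%R.
  rewrite (eq_bigr (fun i : 'I_p.-1 => (d.+1 ^ i)%:R)%R) => [|i _]; last by rewrite natrX -def_u.
  rewrite -natr_sum natr_unit_pk // /dvdn sum_mod -/(p %| _) gtnNdvd //.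
    by rewrite -ltnS prednK ?prime_gt0 ?prime_gt1.
  by rewrite prednK ?prime_gt0.
by rewrite -subr_eq0 -(mulrI_eq0 _ (mulrI sum_unit)) mulrC -subrX1 u_p1 subrr.
Qed.

Lemma sum_uval_mul_eq0 (R : finUnitRingType) (S : {group {unit R}}) (g : {unit R}) :
  g \in S -> (FinRing.uval g - 1 \is a GRing.unit)%R ->
  (\sum_(s in S) FinRing.uval s = 0)%R.
Proof.
move=> Sg Ug1; apply: (mulrI Ug1); rewrite mulr0 mulrBl mul1r mulr_sumr.
(* Substituting [g * s] for [s] on the right matches the summands; the ranges agree since [g] is in
   [S]. *)
apply/eqP; rewrite subr_eq0 [X in _ == X](reindex_inj (mulgI g)) /=.
by apply/eqP/eq_bigl => s; rewrite groupMl.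
Qed.

Theorem theorem1p1 (p k : nat) (p_prime : prime p) (p_odd : odd p)
    (k_ge1 : (1 <= k)%N) (S : {group {unit 'Z_(p ^ k)}})
    (S_sub_core : S \subset core p k) (S_nontrivial : [1]%g \proper S) :
  (\sum_(s in S) FinRing.uval s = 0 :> 'Z_(p ^ k))%R.
Proof.
have [_ [g Sg]] := properP S_nontrivial; rewrite inE => g_neq1.
apply: (sum_uval_mul_eq0 _ _ _ Sg); apply: sub1_unit_pk => //.
(* Lagrange in the core, of order [p.-1], gives [g ^+ p.-1 = 1]. *)
have /eqP := expg_cardG (subsetP S_sub_core g Sg).
by rewrite card_core // => /eqP g_p1; rewrite -FinRing.val_unitX g_p1.
Qed.
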